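(* Let $f\colon X\to X$ be a continuous map on a compact metric space $X$. Let $\{\mathcal X_n\}_{n\ge 0}$ be (indexing sets of) a contracting cofiltration of grids on $X$, and let $\mathcal F_n\colon\mathcal X_n\to 2^{\mathcal X_n}$, $n\ge 0$, be a convergent cofiltration of outer approximations for $f$ defined on it (i.e. each $\mathcal F_n$ is an outer approximation of $f$, and the sequence is both a cofiltration of multivalued mappings and convergent). If $\mathsf R\subset\mathsf{Rep}(X,f)$ is a finite sublattice, then there exists $n_{\mathsf R}$ such that for all $n\ge n_{\mathsf R}$ there exists a lattice monomorphism $\ell_n\colon\mathsf R\to\mathsf{Invset}^-(\mathcal X_n,\mathcal F_n)$ which is a lift of the inclusion $\iota\colon\mathsf R\to\mathsf{Rep}(X,f)$ through $\alpha(|\cdot|)\colon\mathsf{Invset}^-(\mathcal X_n,\mathcal F_n)\to\mathsf{Rep}(X,f)$, i.e. $\alpha(|\ell_n(R)|,f)=R$ for all $R\in\mathsf R$. Furthermore, $\ell_n$ can be chosen such that $|\ell_n(\mathsf R)|=\{|\ell_n(R)| : R\in\mathsf R\}$ is a sublattice of $\mathsf{RNbhd}(X,f)$.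
   Context: Lattices: all lattices are bounded and distributive; lattice homomorphisms preserve $0$ and $1$, and sublattices contain $0$ and $1$. A monomorphism is an injective homomorphism. A lift of $g\colon\mathsf L\to\mathsf K$ through $h\colon\mathsf H\to\mathsf K$ is a lattice homomorphism $\ell\colon\mathsf L\to\mathsf H$ with $g=h\circ\ell$. Continuous dynamics: $f$ is not assumed injective or surjective. For $U\subset X$, $\alpha(U,f)=\bigcap_{n\ge0}\mathrm{cl}\big(\bigcup_{k\ge n}f^{-k}(U)\big)$, where $f^{-k}(U)=(f^k)^{-1}(U)$ is the preimage. $U$ is a repelling neighborhood if $\alpha(U,f)\subset\mathrm{int}(U)$; $R$ is a repeller if $R=\alpha(U,f)$ for some repelling neighborhood $U$. $\mathsf{RNbhd}(X,f)$ (repelling neighborhoods) and $\mathsf{Rep}(X,f)$ (repellers) are lattices with $\vee=\cup$, $\wedge=\cap$, $0=\varnothing$, $1=X$. Grids: a set $S\subset X$ is regular closed if $S=\mathrm{cl}(\mathrm{int}(S))$. A grid on $X$ is a finite family of nonempty regular closed sets $\{|\xi| : \xi\in\mathcal X\}$, indexed by a finite set $\mathcal X$, with $\bigcup_\xi|\xi|=X$ and $|\xi|\cap\mathrm{int}|\xi'|=\varnothing$ for $\xi\ne\xi'$. For $\mathcal U\subset\mathcal X$, $|\mathcal U|=\bigcup_{\xi\in\mathcal U}|\xi|$. Put $\mathrm{diam}(\mathcal X)=\max_{\xi}\mathrm{diam}(|\xi|)$. A grid $\mathcal X'$ is a refinement of $\mathcal X$, written $\mathcal X'\le\mathcal X$,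 if for every $\xi'\in\mathcal X'$ there is exactly one $\xi\in\mathcal X$ with $|\xi'|\subset|\xi|$. A cofiltration of grids is a sequence $\mathcal X_0\ge\mathcal X_1\ge\cdots$; it is contracting if $\mathrm{diam}(\mathcal X_n)\to0$. Multivalued maps: a combinatorial multivalued map $\mathcal F$ on $\mathcal X$ assigns to each $\xi\in\mathcal X$ a subset $\mathcal F(\xi)\subset\mathcal X$; $\mathcal F(\mathcal U)=\bigcup_{\xi\in\mathcal U}\mathcal F(\xi)$; $\mathcal F^{-1}(\xi)=\{\eta : \xi\in\mathcal F(\eta)\}$ and $\mathcal F^{-1}(\mathcal U)=\bigcup_{\xi\in\mathcal U}\mathcal F^{-1}(\xi)$. $\mathsf{Invset}^-(\mathcal X,\mathcal F)=\{\mathcal U\subset\mathcal X : \mathcal F^{-1}(\mathcal U)\subset\mathcal U\}$, a lattice under $\cup,\cap$. $\mathcal F$ is an outer approximation of $f$ if $f(|\xi|)\subset\mathrm{int}|\mathcal F(\xi)|$ for all $\xi\in\mathcal X$. A sequence $\mathcal F_n$ on a cofiltration of grids $\mathcal X_n$ is a cofiltration of multivalued mappings if $\mathcal F_0\ge\mathcal F_1\ge\cdots$, where for $\mathcal X'\le\mathcal X$, $\mathcal F'\le\mathcal F$ means $|\mathcal F'(\mathcal U')|\subset|\mathcal F(\mathcal U)|$ whenever $\mathcal U'\subset\mathcal X'$, $\mathcal U\subset\mathcal X$ and $|\mathcal U'|=|\mathcal U|$. Convergence: for $\rho\ge0$ the $\rho$-minimal map on $\mathcal X$ is $\mathcal F_\rho(\xi)=\{\eta\in\mathcal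 X : B_\rho(f(|\xi|))\cap|\eta|\ne\varnothing\}$, where $B_\rho(S)$ is the $\rho$-neighborhood of $S$ and $B_0(S)=S$; the minimal map is $\mathcal F_{\mathrm o}(\xi)=\{\eta : f(|\xi|)\cap|\eta|\neq\varnothing\}$. A sequence of outer approximations $\mathcal F_n$ on $\mathcal X_n$ converges if $\mathrm{diam}(\mathcal X_n)\to0$ and there are $\rho_n\to0$ such that $\mathcal F_{\mathrm o,n}(\xi)\subset\mathcal F_n(\xi)\subset\mathcal F_{\rho_n}(\xi)$ for all $\xi\in\mathcal X_n$ and all $n$ (minimal and $\rho_n$-minimal maps on $\mathcal X_n$). *)

(* Defs.v *)
From mathcomp Require Import all_boot all_order all_algebra.
From mathcomp Require Import all_classical all_reals all_analysis.

Set Implicit Arguments.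
Unset Strict Implicit.
Unset Printing Implicit Defensive.

Import Order.TTheory GRing.Theory Num.Theory.
Import numFieldNormedType.Exports.

Local Open Scope classical_set_scope.
Local Open Scope ring_scope.

(* All the lattices involved are bounded lattices of subsets of some type,
   with join [`|`], meet [`&`], bottom [set0] and top [setT]; they are given by
   their carrier [L : set (set T)].  A map between two of them is a total
   function of which only the values on the carrier matter.
   The library's [{tblmorphism _ -> _}] only asks for [\bot] and [\top] to be
   preserved, hence the explicit definitions below. *)

Record sublattice (T : Type) (L S : set (set T)) : Prop := Sublattice {
  sublattice_subset : S `<=` L;
  sublattice_set0 : S set0;
  sublattice_setT : S setT;
  sublattice_setU : forall A B, S A -> S B -> S (A `|` B);
  sublattice_setI : forall A B, S A -> S B -> S (A `&` B) }.

Record lattice_hom (T1 T2 : Type) (L : set (set T1)) (H : set (set T2))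
    (l : set T1 -> set T2) : Prop := LatticeHom {
  lattice_hom_fun : set_fun L H l;
  lattice_hom_set0 : l set0 = set0;
  lattice_hom_setT : l setT = setT;
  lattice_hom_setU : forall A B, L A -> L B -> l (A `|` B) = l A `|` l B;
  lattice_hom_setI : forall A B, L A -> L B -> l (A `&` B) = l A `&` l B }.

Definition lattice_mono (T1 T2 : Type) (L : set (set T1)) (H : set (set T2))
    (l : set T1 -> set T2) : Prop :=
  lattice_hom L H l /\ set_inj L l.

(* [l : L -> H] is a lift of [g : L -> K] through [h : H -> K] *)
Definition lattice_lift (T1 T2 T3 : Type) (L : set (set T1))
    (H : set (set T2)) (g : set T1 -> set T3) (h : set T2 -> set T3)
    (l : set T1 -> set T2) : Prop :=
  lattice_hom L H l /\ {in L, g =1 h \o l}.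

Section dynamics.
Context {X : topologicalType}.
Implicit Types (f : X -> X) (U : set X).

Definition alpha f U : set X :=
  \bigcap_n closure (\bigcup_(k in [set k | (n <= k)%N]) (iter k f @^-1` U)).

Definition RNbhd f : set (set X) := [set U | alpha f U `<=` U°].

Definition Rep f : set (set X) := [set R | exists2 U, RNbhd f U & R = alpha f U].

End dynamics.

Section grids.
Context {R : realType} {X : metricType R}.

(* A grid is a family [g : C -> set X] indexed by a finite type [C]; subsets of
   [C] are taken in [set C]. *)
Record grid (C : finType) (g : C -> set X) : Prop := Grid {
  grid_nonempty : forall c, g c !=set0;
  grid_regclosed : forall c, regclosed (g c);
  grid_cover : \bigcup_c g c = setT;
  grid_disjoint : forall c c', c != c' -> g c `&` (g c')° = set0 }.

Definition realization (C : finType) (g : C -> set X) (U : set C) : set X :=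
  \bigcup_(c in U) g c.

(* Real-valued supremum: meaningful for nonempty bounded sets only, which the
   elements of a grid on a compact space are. *)
Definition diam (S : set X) : R := sup [set mdist p.1 p.2 | p in S `*` S].

(* The default value 0 is reached only by the empty grid, since [diam >= 0]. *)
Definition grid_diam (C : finType) (g : C -> set X) : R :=
  \big[Num.max/0]_c diam (g c).

Definition refinement (C' C : finType) (g' : C' -> set X) (g : C -> set X) : Prop :=
  forall c', exists! c, g' c' `<=` g c.

Definition grid_cofiltration (C : nat -> finType) (g : forall n, C n -> set X) : Prop :=
  (forall n, grid (g n)) /\ (forall n, refinement (g n.+1) (g n)).

Definition contracting (C : nat -> finType) (g : forall n, C n -> set X) : Prop :=
  grid_diam (g n) @[n --> \oo] --> (0 : R).

End grids.

Definition image_mv (C : finType) (F : C -> set C) (U : set C) : set C :=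
  \bigcup_(c in U) F c.

Definition inverse_mv (C : finType) (F : C -> set C) (c : C) : set C :=
  [set e | F e c].

Definition Invset_minus (C : finType) (F : C -> set C) : set (set C) :=
  [set U | image_mv (inverse_mv F) U `<=` U].

Section multivalued_maps.
Context {R : realType} {X : metricType R}.

Definition outer_approximation (f : X -> X) (C : finType) (g : C -> set X)
    (F : C -> set C) : Prop :=
  forall c, f @` g c `<=` (realization g (F c))°.

Definition mv_le (C' C : finType) (g' : C' -> set X) (g : C -> set X)
    (F' : C' -> set C') (F : C -> set C) : Prop :=
  forall (U' : set C') (U : set C), realization g' U' = realization g U ->
    realization g' (image_mv F' U') `<=` realization g (image_mv F U).

Definition mv_cofiltration (C : nat -> finType) (g : forall n, C n -> set X)
    (F : forall n, C n -> set (C n)) : Prop :=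
  forall n, mv_le (g n.+1) (g n) (F n.+1) (F n).

(* Open neighborhood for [0 < rho]; [ball x 0] is empty, whence the test. *)
Definition rho_nbhd (rho : R) (S : set X) : set X :=
  if rho == 0 then S else \bigcup_(x in S) ball x rho.

Definition minimal_map (f : X -> X) (C : finType) (g : C -> set X) (c : C) : set C :=
  [set e | (f @` g c) `&` g e !=set0].

Definition rho_minimal_map (rho : R) (f : X -> X) (C : finType)
    (g : C -> set X) (c : C) : set C :=
  [set e | rho_nbhd rho (f @` g c) `&` g e !=set0].

Definition mv_converges (f : X -> X) (C : nat -> finType)
    (g : forall n, C n -> set X) (F : forall n, C n -> set (C n)) : Prop :=
  contracting g /\
  exists rho : nat -> R,
    [/\ forall n, 0 <= rho n,
        rho n @[n --> \oo] --> (0 : R) &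
        forall n c, minimal_map f (g n) c `<=` F n c /\
                    F n c `<=` rho_minimal_map (rho n) f (g n) c].

End multivalued_maps.

(* Main.v *)
Require Import Defs.
From mathcomp Require Import all_boot all_order all_algebra.
From mathcomp Require Import all_classical all_reals all_analysis.
From mathcomp Require Import lra.
Set Implicit Arguments.
Unset Strict Implicit.
Unset Printing Implicit Defensive.
Import Order.TTheory GRing.Theory Num.Theory.
Import numFieldNormedType.Exports.
Local Open Scope classical_set_scope.
Local Open Scope ring_scope.

(** Write B_r(A) for the r-thickening of A, and for a cell set U write |U| for
its realization.

Two facts make single repellers easy. If U is closed under F^-1, then the outer
approximation property gives f^-1(|U|) in the interior of |U|
([realization_preimage_interior]); hence |U| is automatically a repelling
neighborhood, and its alpha-limit set is the set of points whose orbits stay in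
|U|. Consequently, if |U| contains a repeller A and lies in some repelling
neighborhood with alpha-limit set A, then alpha(|U|) = A. Conversely every
repeller J has arbitrarily small neighborhoods V which are backward closed with
a uniform margin: if f(x) is e-close to V then x is in V ([repeller_block]). On fine
enough grids one step of F is an e-pseudo-orbit step of f, so the smallest
F^-1-closed cell set containing all cells that meet B_e(J), called
[back_nbhd], stays in a prescribed B_d(J) ([back_nbhd_small]).

The difficulty is to make the choices compatible with unions and, for the
realizations, with intersections. Thickening by one radius commutes with unions,
but B_e(A) and B_e(B) meet in more than B_e(A & B). The remedy is to use larger
radii for smaller repellers. By compactness, for each d there is e <= d such
that the back neighborhoods of radius e of any J1 and J2 in S have
intersection inside B_d(J1 & J2) ([back_nbhdI_small]); iterating gives radii
d_0 >= d_1 >= ... . Let W(J) have radius d_(h(J)+1), with h(J) the number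
of members of S strictly below J, and put l(A) = union of the W(J) over J in S
below A ([layered_lift]). If J1 and J2 are incomparable, then K = J1 & J2 has
smaller level than both, so |W(J1)| and |W(J2)| meet inside the thickening of K
that generates W(K): l preserves intersections, also after realization.
If J is below the union of A and B, then J is the union of J & A and J & B, which
have larger radii than J: l preserves unions. *)

(** * Compactness in metric spaces *)

Section compact_metric.
Context {R : realType} {X : metricType R}.
Implicit Types (f : X -> X) (A B J O : set X) (r d e : R).

Definition thickening (r : R) (A : set X) : set X := \bigcup_(x in A) ball x r.

Lemma sub_thickening r A : 0 < r -> A `<=` thickening r A.
Proof. by move=> r0 x Ax; exists x => //; exact: ballxx. Qed.

Lemma thickening_le r d A B :
  r <= d -> A `<=` B -> thickening r A `<=` thickening d B.
Proof. by move=> rd AB x [y Ay yx]; exists y; [exact: AB|exact: le_ball yx]. Qed.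

Lemma thickening_ball r e A x y :
  thickening r A x -> ball x e y -> thickening (r + e) A y.
Proof. by move=> [a Aa ax] xy; exists a => //; exact: ball_triangle ax xy. Qed.

Lemma thickening_open r A : open (thickening r A).
Proof.
apply: bigcup_open => x _; rewrite openE => y xy; rewrite ballEmdist/= in xy.
apply/nbhs_ballP; exists (r - mdist x y) => /=; first by rewrite subr_gt0.
move=> z yz; rewrite ballEmdist/= in yz; rewrite ballEmdist/=.
by apply: le_lt_trans (metric_triangle x y z) _; rewrite -ltrBrDl.
Qed.

Context (cX : compact [set: X]).

Lemma closed_compactT A : closed A -> compact A.
Proof. by move=> cA; apply: subclosed_compact cX _. Qed.

Lemma thickening_sub_open A O : closed A -> open O -> A `<=` O ->
  exists2 d, 0 < d & thickening d A `<=` O.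
Proof.
move=> cA oO AO.
have /compact_near_coveringP/(_ R (0^'+) (fun d x => ball x d `<=` O)) := closed_compactT cA.
case.
  move=> x /AO Ox; have /nbhs_ballP[e /= e0 xeO] := open_nbhs_nbhs (conj oO Ox).
  near=> y d => z /= yz; apply: xeO; apply: (@ball_split _ _ y).
    by near: y; apply/nbhs_ballP; exists (e / 2) => //=; rewrite divr_gt0.
  by apply: le_ball yz; apply/ltW => /=; near: d; apply: nbhs_right_lt; rewrite divr_gt0.
move=> d /= d0 AdO; exists (d / 2); first by rewrite divr_gt0.
move=> x [a Aa ax]; apply: (AdO (d/2)) ax => //=; last by rewrite divr_gt0.
by rewrite /ball/= sub0r normrN gtr0_norm ?divr_gt0 // ltr_pdivrMr // ltr_pMr // ltr1n.
Unshelve. all: by end_near. Qed.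

(** Near-covering compactness: outside O, each point has a
neighborhood that misses all late V_n. *)
Lemma nested_closed_sub_open (V : nat -> set X) O :
  (forall n, closed (V n)) -> (forall m n, (m <= n)%N -> V n `<=` V m) ->
  open O -> \bigcap_n V n `<=` O -> exists n, V n `<=` O.
Proof.
move=> cV decV oO VO.
have /compact_near_coveringP/(_ nat \oo (fun n x => V n x -> O x)) := cX.
case=> [x _|N _ /(_ N (leqnn N)) VNO]; last by exists N => x /(VNO x I).
have [Ox|/(contra_not (VO x)) nV] := pselect (O x).
  by near=> y n => _ /=; near: y; exact: open_nbhs_nbhs.
have /existsNP[n Vnx] : ~ forall n, V n x by move=> Vx; apply: nV => // k _.
near=> y m => /= Vmy; exfalso.
have : V n y by apply: (decV n m) Vmy; near: m; exact: nbhs_infty_ge.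
near: y; apply: open_nbhs_nbhs; split => //; exact: closed_openC.
Unshelve. all: by end_near. Qed.

Lemma unif_continuous_compact f : continuous f -> forall e, 0 < e ->
  exists2 d, 0 < d & forall x y, ball x d y -> ball (f x) e (f y).
Proof.
move=> cf e e0.
have e20 : 0 < e / 2 by rewrite divr_gt0.
have /compact_near_coveringP/(_ R (0^'+)
  (fun d x => forall y, ball x d y -> ball (f x) e (f y))) := cX.
case.
  move=> x _; have /nbhs_ballP[d /= d0 dP] := cf x _ (nbhsx_ballx (f x) _ e20).
  near=> y r => z /= yz; apply: (@ball_split _ _ (f x)).
    apply/ball_sym/dP; apply: (@le_ball _ _ _ (d/2)); first by lra.
    by near: y; apply/nbhs_ballP; exists (d / 2) => //=; rewrite divr_gt0.
  apply: dP; apply: (@ball_split _ _ y).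
    by near: y; apply/nbhs_ballP; exists (d / 2) => //=; rewrite divr_gt0.
  by apply: le_ball yz; apply/ltW => /=; near: r; apply: nbhs_right_lt; rewrite divr_gt0.
move=> d /= d0 dP; exists (d / 2); first by rewrite divr_gt0.
move=> x y xy; apply: (dP (d/2)) xy => //=; last by rewrite divr_gt0.
by rewrite /ball/= sub0r normrN gtr0_norm ?divr_gt0 // ltr_pdivrMr // ltr_pMr // ltr1n.
Unshelve. all: by end_near. Qed.

Lemma unif_continuous_iter f m : continuous f -> forall e, 0 < e ->
  exists2 d, 0 < d & forall x y k, (k <= m)%N -> ball x d y ->
    ball (iter k f x) e (iter k f y).
Proof.
move=> cf; elim: m => [|m IH] e e0.
  by exists e => // x y k; rewrite leqn0 => /eqP ->.
have [d1 d10 d1P] := unif_continuous_compact cf e0.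
have [d2 d20 d2P] := IH _ d10.
have [d3 d30 d3P] := IH _ e0.
exists (Order.min d2 d3); first by rewrite lt_min d20.
move=> x y k; rewrite leq_eqVlt => /predU1P[->|km] xy.
  by rewrite !iterS; apply/d1P/d2P => //; apply: le_ball xy; rewrite ge_min lexx.
by apply: d3P => //; apply: le_ball xy; rewrite ge_min lexx orbT.
Qed.

(** Outside a neighborhood O of J1 & J2, the closed set J1 is at positive distance
from J2; a common point of two thin thickenings is therefore close to a point
of J1 in O. *)
Lemma thickeningI J1 J2 d : closed J1 -> closed J2 -> 0 < d ->
  exists2 e, 0 < e & thickening e J1 `&` thickening e J2 `<=` thickening d (J1 `&` J2).
Proof.
move=> c1 c2 d0.
have d20 : 0 < d / 2 by rewrite divr_gt0.
pose O := thickening (d / 2) (J1 `&` J2).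
have cJO : closed (J1 `\` O).
  by apply: closedI => //; apply: open_closedC; exact: thickening_open.
have [|e e0 eP] := thickening_sub_open cJO (closed_openC c2).
  by move=> x [J1x Ox] J2x; apply: Ox; exact: sub_thickening.
exists (Order.min (d / 2) (e / 2)); first by rewrite lt_min d20 divr_gt0.
move=> x [[j1 J1j1 j1x] [j2 J2j2 j2x]].
have [Oj1|nO] := pselect (O j1).
  rewrite [d]splitr; apply: thickening_ball Oj1 _.
  by apply: le_ball j1x; rewrite ge_min lexx.
exfalso; apply: (eP j2) J2j2; exists j1 => //; apply: (@ball_split _ _ x).
  by apply: le_ball j1x; rewrite ge_min lexx orbT.
by apply/ball_sym; apply: le_ball j2x; rewrite ge_min lexx orbT.
Qed.

(** Compactness enters because [diam] is a real supremum, meaningful on bounded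
sets only. *)
Lemma diam_upper_bound (S : set X) x y : S x -> S y -> mdist x y <= diam S.
Proof.
move=> Sx Sy; apply: ub_le_sup; last by exists (x, y).
have /compact_near_coveringP/(_ nat \oo (fun n z => ball x n%:R z)) := cX.
case=> [z _|N _ /(_ N (leqnn N)) xN].
  near=> z' n => /=; rewrite ballEmdist/=.
  have : ball x (mdist x z + 1 + 1) z'.
    apply: (@ball_triangle _ _ z); first by rewrite ballEmdist/= ltrDl.
    by near: z'; exact: nbhsx_ballx.
  rewrite ballEmdist/= => /lt_le_trans; apply.
  by near: n; exact: nbhs_infty_ger.
exists (N%:R + N%:R) => _ [[a b] [_ _] <-] /=; apply: ltW.
have : ball a (N%:R + N%:R) b.
  by apply: (@ball_triangle _ _ x); [apply/ball_sym; exact: xN|exact: xN].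
by rewrite ballEmdist.
Unshelve. all: by end_near. Qed.

End compact_metric.

(** * Alpha-limit sets and repellers *)

Section alpha_limits.
Context {X : topologicalType}.
Implicit Types (f : X -> X) (J U : set X).

Lemma alpha_closed f U : closed (alpha f U).
Proof. by apply: closed_bigI => n _; exact: closed_closure. Qed.

Lemma alpha_forward f U k x :
  continuous f -> alpha f U x -> alpha f U (iter k f x).
Proof.
move=> cf; elim: k => //= k IH /IH {}IH n _.
move=> B /cf /(IH n.+1 I) [z [[[|i] //= ni iz] Bz]].
by exists (f z); split => //; exists i => //=; rewrite -iterSr.
Qed.

(** Together with [RNbhd_alpha_iter] below, this identifies the alpha-limit set
of a repelling neighborhood with the set of points whose orbits never leave it. *)
Lemma staying_alpha f U x : (forall k, U (iter k f x)) -> alpha f U x.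
Proof. by move=> Ux n _; apply: subset_closure; exists n => /=. Qed.

Lemma RNbhd_alpha_iter f U x k :
  continuous f -> RNbhd f U -> alpha f U x -> U (iter k f x).
Proof.
by move=> cf rU ax; apply: interior_subset; apply: rU; exact: alpha_forward.
Qed.

Lemma Rep_forward f J x k : continuous f -> Rep f J -> J x -> J (iter k f x).
Proof. by move=> cf [U _ ->]; exact: alpha_forward. Qed.

Lemma Rep_closed f J : Rep f J -> closed J.
Proof. by move=> [U _ ->]; exact: alpha_closed. Qed.

End alpha_limits.

Section repeller_blocks.
Context {R : realType} {X : metricType R}.
Implicit Types (f : X -> X) (J U V : set X) (d e : R).

(** Let U be a repelling neighborhood of J. The obvious candidates for V,
intersections of preimages of one thickening of J, are backward closed but with
no margin. The margin comes from radii r_0 < ... < r_m growing along the orbit: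
V consists of the x with f^k(x) in B_(r_k)(J) for k <= m. Pulling V back shifts
the indices by one, so that each condition but the first is gained with room to
spare, and the first holds because the (m+1)-st preimage of U is already within
r_0 of J. *)
Lemma repeller_block f J d : compact [set: X] -> continuous f ->
  Rep f J -> 0 < d ->
  exists V, exists2 e, 0 < e & [/\ V `<=` thickening d J, thickening e J `<=` V &
    forall x y, ball (f x) e y -> V y -> V x].
Proof.
move=> cX cf RJ d0; have cJ := Rep_closed RJ; have [U rU JU] := RJ.
have [d1 d10 d1U] : exists2 d, 0 < d & thickening d J `<=` U°.
  by apply: thickening_sub_open => //; [exact: open_interior|rewrite JU].
(* The radii start at a and reach 2 a, the minimum of d and d1, at step m.+1,
   which allows m.+1 increments of size s. *)
pose a := Order.min d d1 / 2.
have a0 : 0 < a by rewrite divr_gt0// lt_min d0.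
(* The sets whose intersection is alpha f U = J shrink into B_a(J). *)
have [m mP] : exists m, closure (\bigcup_(k in [set k | (m <= k)%N])
    (iter k f @^-1` U)) `<=` thickening a J.
  apply: (nested_closed_sub_open cX) => [n|p q pq||].
  - exact: closed_closure.
  - by apply/closure_subset/bigcup_subset => k /=; exact: leq_trans.
  - exact: thickening_open.
  - by rewrite -/(alpha f U) -JU; exact: sub_thickening.
have am1 : 0 < m.+1%:R :> R by rewrite ltr0n.
pose s := a / m.+1%:R; have s0 : 0 < s by rewrite divr_gt0.
pose r k := a + k%:R * s.
have rlast : r m.+1 = Order.min d d1.
  by rewrite /r /s mulrC divfK ?gt_eqF // /a -splitr.
have rS k : r k.+1 = r k + s by rewrite /r -natr1 mulrDl mul1r addrA.
have rge k : a <= r k by rewrite lerDl mulr_ge0 // ltW.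
have rmono k l : (k <= l)%N -> r k <= r l.
  by move=> kl; rewrite lerD2l ler_wpM2r ?ler_nat // ltW.
pose V := [set x | forall k, (k <= m)%N -> thickening (r k) J (iter k f x)].
have [e e0 eP] := unif_continuous_iter cX m cf s0.
exists V, e => //; split.
- move=> x /(_ 0%N (leq0n _)) /=; apply: thickening_le => //.
  by apply: le_trans (rmono _ m.+1 _) _ => //; rewrite rlast ge_min lexx.
- move=> x [j Jj jx] k km; exists (iter k f j); first exact: Rep_forward.
  have : ball (iter k f j) s (iter k f x) by exact: eP.
  apply: le_ball; apply: le_trans (rge k).
  by rewrite /s ler_pdivrMr// ler_pMr// ler1n.
move=> x y xy Vy.
have step k : (k <= m)%N -> thickening (r k.+1) J (iter k.+1 f x).
  move=> km; rewrite rS iterSr; apply: thickening_ball (Vy k km) _.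
  by apply/ball_sym/eP.
case=> [_|k km]; last exact/step/ltnW.
have Ux : U (iter m.+1 f x).
  apply: interior_subset; apply: d1U; apply: (thickening_le _ _ (step m (leqnn m))) => //.
  by rewrite rlast ge_min lexx orbT.
rewrite /r mul0r addr0; apply: mP; apply: subset_closure.
by exists m.+1 => //=.
Qed.

End repeller_blocks.

(** * Backward closed sets of cells *)

Section backward_closure.
Context {C : finType}.
Implicit Types (F : C -> set C) (U V W : set C).

Lemma Invset_minusP F U : Invset_minus F U <-> forall c e, F c e -> U e -> U c.
Proof.
split=> [FU c e ce Ue|FU c [e Ue ce]]; last exact: FU ce Ue.
by apply: FU; exists e.
Qed.

Lemma Invset_minus_bigcup (T : Type) F (D : set T) (U : T -> set C) :
  (forall i, D i -> Invset_minus F (U i)) -> Invset_minus F (\bigcup_(i in D) U i).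
Proof.
move=> FU; apply/Invset_minusP => c e ce [i Di Ue]; exists i => //.
by have /Invset_minusP := FU i Di; apply; [exact: ce|].
Qed.

Definition back_closure F U : set C :=
  \bigcap_(V in [set V | Invset_minus F V /\ U `<=` V]) V.

Lemma back_closure_Invset F U : Invset_minus F (back_closure F U).
Proof.
apply/Invset_minusP => c e ce Ue V [FV UV].
by have /Invset_minusP := FV; apply; [exact: ce|exact: Ue].
Qed.

Lemma sub_back_closure F U : U `<=` back_closure F U.
Proof. by move=> c Uc V [_]; apply. Qed.

Lemma back_closure_min F U V : Invset_minus F V -> U `<=` V ->
  back_closure F U `<=` V.
Proof. by move=> FV UV c; apply. Qed.

End backward_closure.

Section grids.
Context {R : realType} {X : metricType R} {C : finType} (g : C -> set X).
Implicit Types (F : C -> set C) (U V : set C) (A : set X).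

Lemma realizationU U V :
  realization g (U `|` V) = realization g U `|` realization g V.
Proof. exact: bigcup_setU. Qed.

Lemma realization_subset U V : U `<=` V -> realization g U `<=` realization g V.
Proof. by move=> UV; exact: bigcup_subset. Qed.

Context (gg : grid g).

Lemma realization_closed U : closed (realization g U).
Proof.
apply: closed_bigcup => [|c _]; first exact: finite_finset.
by rewrite -(grid_regclosed gg c); exact: closed_closure.
Qed.

(** Regular closedness makes each point of a cell a limit of interior points of
that cell, which lie in no other cell. *)
Lemma realization_cell_complement U c : U c ->
  g c `&` (realization g (~` U))° = set0.
Proof.
move=> Uc; apply/eqP; apply: contrapT => /negP/set0P[x [gx Ix]].
move: gx; rewrite -(grid_regclosed gg c) => /(_ _ Ix)[y [gy [e Ue ge]]].
have ec : e != c by apply/eqP => ec; apply: Ue; rewrite ec.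
have /seteqP[+ _] := grid_disjoint gg ec.
by move=> /(_ y); apply; split.
Qed.

Lemma realizationC_sub U : ~` realization g (~` U) `<=` (realization g U)°.
Proof.
rewrite -open_subsetE; last exact: closed_openC (@realization_closed _).
move=> x nx; have [c _ gc] : (\bigcup_c g c) x by rewrite (grid_cover gg).
exists c => //; apply: contrapT => nUc; apply: nx; by exists c.
Qed.

(** The cells outside U form a forward closed set, which f maps into the
interior of its realization by outer approximation; and that interior
avoids |U|. *)
Lemma realization_preimage_interior f F U :
  outer_approximation f g F -> Invset_minus F U ->
  f @^-1` realization g U `<=` (realization g U)°.
Proof.
move=> oF /Invset_minusP FU x /= [c Uc fxc].
apply: realizationC_sub => -[e nUe gex].
have : (g c `&` (realization g (~` U))°) (f x).
  split=> //; have : (f @` g e) (f x) by exists x.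
  move=> /oF; apply: interiorS; apply: realization_subset => a Fea Ua.
  by apply: nUe; exact: FU Fea Ua.
by rewrite realization_cell_complement.
Qed.

Lemma Invset_minus_RNbhd f F U : continuous f ->
  outer_approximation f g F -> Invset_minus F U ->
  RNbhd f (realization g U).
Proof.
move=> cf oF FU; have fU := realization_preimage_interior oF FU.
have iterU k : iter k.+1 f @^-1` realization g U `<=` f @^-1` realization g U.
  elim: k => // k IH x /=; rewrite -iterS iterSr => /IH /=.
  by move=> /fU /interior_subset.
apply: subset_trans fU => x /(_ 1%N I).
have /closure_id -> : closed (f @^-1` realization g U).
  by apply: preimage_closed (@realization_closed _) => z _; exact: cf.
by apply: closure_subset => y [[|k] //= _]; exact: iterU.
Qed.

Definition cells_meeting A : set C := [set c | g c `&` A !=set0].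

Lemma cells_meeting_subset A B : A `<=` B -> cells_meeting A `<=` cells_meeting B.
Proof. by move=> AB c [x [gx /AB Bx]]; exists x. Qed.

Lemma sub_realization_cells_meeting A : A `<=` realization g (cells_meeting A).
Proof.
move=> x Ax; have [c _ gc] : (\bigcup_c g c) x by rewrite (grid_cover gg).
by exists c => //; exists x.
Qed.

(** Backward orbits of cells may go far from A; around a repeller, on fine grids,
[back_nbhd_small] shows that they do not. *)
Definition back_nbhd F (e : R) A : set C :=
  back_closure F (cells_meeting (thickening e A)).

Lemma back_nbhd_subset F (e e' : R) A B : e <= e' -> A `<=` B ->
  back_nbhd F e A `<=` back_nbhd F e' B.
Proof.
move=> ee' AB; apply: back_closure_min; first exact: back_closure_Invset.
apply: subset_trans (@sub_back_closure _ _ _).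
by apply: cells_meeting_subset; exact: thickening_le.
Qed.

Lemma back_nbhdU F (e : R) A B :
  back_nbhd F e (A `|` B) `<=` back_nbhd F e A `|` back_nbhd F e B.
Proof.
apply: back_closure_min => [|c [x [gx [a [Aa|Ba] ax]]]].
- rewrite -bigcup2E; apply: Invset_minus_bigcup => -[|[|i]] _ //=;
    by [exact: back_closure_Invset|apply/Invset_minusP].
- by left; apply: sub_back_closure; exists x; split=> //; exists a.
- by right; apply: sub_back_closure; exists x; split=> //; exists a.
Qed.

Lemma thickening_sub_back_nbhd F (e : R) A :
  thickening e A `<=` realization g (back_nbhd F e A).
Proof.
apply: subset_trans (@sub_realization_cells_meeting _) _.
by apply: realization_subset; exact: sub_back_closure.
Qed.

End grids.

(** * Small backward closed neighborhoods on fine grids *)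

Section fine_grids.
Context {R : realType} {X : metricType R} {f : X -> X}
  {C : nat -> finType} {g : forall n, C n -> set X}
  {F : forall n, C n -> set (C n)}.
Arguments g : clear implicits.
Arguments F : clear implicits.
Implicit Types (A J : set X) (d e : R).
Context (cX : compact [set: X]) (cf : continuous f)
  (convF : mv_converges f g F).

Lemma cells_small e : 0 < e ->
  \forall n \near \oo, forall (c : C n) x y, g n c x -> g n c y -> ball x e y.
Proof.
move=> e0; have /cvgrPdist_lt/(_ e e0) := convF.1.
apply: filterS => n; rewrite sub0r normrN => ne c x y gx gy.
rewrite ballEmdist/=; apply: le_lt_trans (diam_upper_bound cX gx gy) _.
apply: le_lt_trans ne; apply: le_trans (ler_norm _).
exact: (le_bigmax 0 (fun c => diam (g n c)) c).
Qed.

(** The image of F n c lies within rho_n of f(|c|), and uniform continuity makes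
f(|c|) small, so any point of the cell c can be used to start the step. *)
Lemma cell_pseudo_orbit e : 0 < e ->
  \forall n \near \oo, forall (c c' : C n), F n c c' ->
    forall x, g n c x -> exists2 y, g n c' y & ball (f x) e y.
Proof.
move=> e0; have e20 : 0 < e / 2 by rewrite divr_gt0.
have [d d0 dP] := unif_continuous_compact cX cf e20.
have [_ [rho [rho0 /cvgrPdist_lt/(_ _ e20) rhoe FP]]] := convF.
near=> n => c c' cc' x gx.
have /(_ _ cc')[y [+ gy]] := (FP n c).2.
have rne : rho n < e / 2.
  rewrite -[rho n]ger0_norm// -normrN -sub0r.
  by near: n.
suff near_image : rho_nbhd (rho n) (f @` g n c) y -> exists2 x', g n c x' & ball (f x') (e / 2) y.
  move=> /near_image[x' gx' x'y]; exists y => //.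
  apply: ball_split x'y; apply: dP.
  have : forall (c : C n) x y, g n c x -> g n c y -> ball x d y.
    by near: n; exact: cells_small.
  by apply; [exact: gx|exact: gx'].
rewrite /rho_nbhd; case: ifP => _.
  by move=> [x' gx' <-]; exists x' => //; exact: ballxx.
by move=> [_ [x' gx' <-] x'y]; exists x' => //; apply: le_ball x'y; exact: ltW.
Unshelve. all: by end_near. Qed.

(** The cells contained in a block V of J form a backward closed set, since steps
of F are pseudo-orbit steps within the margin of V. *)
Lemma back_nbhd_small J d : Rep f J -> 0 < d ->
  exists2 e, 0 < e & \forall n \near \oo,
    realization (g n) (back_nbhd (g n) (F n) e J) `<=` thickening d J.
Proof.
move=> RJ d0; have [V [e e0 [VJ JV pseudoV]]] := repeller_block cX cf RJ d0.
have e20 : 0 < e / 2 by rewrite divr_gt0.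
exists (e / 2) => //; near=> n.
apply: subset_trans VJ => x [c Bc gx].
suff sub : back_nbhd (g n) (F n) (e / 2) J `<=` [set c | g n c `<=` V].
  exact: sub Bc _ gx.
apply: back_closure_min.
  apply/Invset_minusP => a b Fab /= bV z gz.
  have [y gy zy] : exists2 y, g n b y & ball (f z) e y.
    have : forall (c c' : C n), F n c c' ->
      forall x, g n c x -> exists2 y, g n c' y & ball (f x) e y.
      by near: n; exact: cell_pseudo_orbit.
    by move=> /(_ a b Fab z gz).
  by apply: pseudoV zy _; exact: bV.
move=> a [y [gy [j Jj jy]]] z gz; apply: JV; exists j => //.
apply: ball_split jy _.
have : forall (c : C n) x y, g n c x -> g n c y -> ball x (e / 2) y.
  by near: n; exact: cells_small.
by apply; [exact: gy|exact: gz].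
Unshelve. all: by end_near. Qed.

Lemma back_nbhdI_small J1 J2 d : Rep f J1 -> Rep f J2 -> 0 < d ->
  exists2 e, 0 < e & \forall n \near \oo,
    realization (g n) (back_nbhd (g n) (F n) e J1) `&`
    realization (g n) (back_nbhd (g n) (F n) e J2) `<=` thickening d (J1 `&` J2).
Proof.
move=> R1 R2 d0.
have [a a0 aP] := thickeningI cX (Rep_closed R1) (Rep_closed R2) d0.
have [e1 e10 e1P] := back_nbhd_small R1 a0.
have [e2 e20 e2P] := back_nbhd_small R2 a0.
exists (Order.min e1 e2); first by rewrite lt_min e10.
apply: filterS2 e1P e2P => n n1 n2.
apply: subset_trans aP; apply: setISS.
  apply: subset_trans n1; apply: realization_subset; apply: back_nbhd_subset => //.
  by rewrite ge_min lexx.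
apply: subset_trans n2; apply: realization_subset; apply: back_nbhd_subset => //.
by rewrite ge_min lexx orbT.
Qed.

End fine_grids.

(** Shrinking the radius preserves P, so finitely many radii have a common
minimum. *)
Lemma finite_uniform_radius (R : realType) (T : eqType) (D : set T)
    (P : R -> T -> nat -> Prop) :
  finite_set D ->
  (forall e e' t n, e' <= e -> P e t n -> P e' t n) ->
  (forall t, D t -> exists2 e, 0 < e & \forall n \near \oo, P e t n) ->
  exists2 e, 0 < e & \forall n \near \oo, forall t, D t -> P e t n.
Proof.
move=> /finite_seqP[s ->] Pmono; elim: s => [_|t s IH DP].
  by exists 1 => //; near=> n.
have [e1 e10 e1P] := DP t (mem_head _ _).
have [|e2 e20 e2P] := IH; first by move=> u us; apply: DP; rewrite /= inE (us : u \in s) orbT.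
exists (Order.min e1 e2); first by rewrite lt_min e10.
apply: filterS2 e1P e2P => n n1 n2 u; rewrite /= inE => /predU1P[->|us].
  by apply: Pmono n1; rewrite ge_min lexx.
by apply: Pmono (n2 u us); rewrite ge_min lexx orbT.
Unshelve. all: by end_near. Qed.

Lemma count_lt (T : eqType) (a b : pred T) (s : seq T) x :
  subpred a b -> x \in s -> b x -> ~~ a x -> (count a s < count b s)%N.
Proof.
move=> ab xs bx ax; elim: s xs => //= y s IH; rewrite inE => /predU1P[<-|xs].
  by rewrite bx (negbTE ax) add0n add1n ltnS; exact: sub_count.
by rewrite -addnS leq_add ?IH//; case: (a y) (ab y) => [->|_].
Qed.

(** A bounded rank for strict inclusion, which will index the radii; the number of
members of S strictly below a set is one. *)
Lemma strict_subset_level (T : Type) (S : set (set T)) : finite_set S ->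
  exists (N : nat) (h : set T -> nat),
    (forall J, (h J <= N)%N) /\ forall K J, S K -> K `<` J -> (h K < h J)%N.
Proof.
move=> /finite_seqP[s ->].
pose below J : pred (set T) := fun K => `[< K `<` J >].
exists (size s), (fun J => count (below J) s); split=> [J|K J /= Ks KJ].
  exact: count_size.
apply: count_lt Ks _ _.
- move=> L /asboolP [LK nKL]; apply/asboolP; split; first exact: subset_trans KJ.1.
  by move=> JL; apply: nKL; apply: subset_trans JL; exact: KJ.1.
- exact/asboolP.
- by apply/asboolP => /properxx.
Qed.

(** * The layered lift of a finite lattice *)

Section layered_lift.
Context {R : realType} {X : metricType R} {C : finType} (g : C -> set X)
  (F : C -> set C).
Context (S : set (set X)) (N : nat) (h : set X -> nat) (d : nat -> R).
Implicit Types A B J K : set X.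

Context (gg : grid g).
Context (ST : S setT) (SI : forall A B, S A -> S B -> S (A `&` B)).
Context (h_le : forall J, (h J <= N)%N)
  (h_lt : forall K J, S K -> K `<` J -> (h K < h J)%N).
Context (d_gt0 : forall i, 0 < d i)
  (d_anti : forall i j, (i <= j)%N -> d j <= d i).
Context (d_separates : forall i J1 J2, (i <= N)%N -> S J1 -> S J2 ->
  realization g (back_nbhd g F (d i.+1) J1) `&`
  realization g (back_nbhd g F (d i.+1) J2) `<=` thickening (d i) (J1 `&` J2)).

Let W J := back_nbhd g F (d (h J).+1) J.

Definition layered_lift A : set C :=
  \bigcup_(J in [set J | S J /\ J `<=` A]) W J.

Lemma layered_lift_Invset A : Invset_minus F (layered_lift A).
Proof. by apply: Invset_minus_bigcup => J _; exact: back_closure_Invset. Qed.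

Lemma layered_lift_subset A B : A `<=` B -> layered_lift A `<=` layered_lift B.
Proof. by move=> AB c [J [SJ JA]]; exists J => //; split=> // x /JA/AB. Qed.

Lemma layered_lift0 : layered_lift set0 = set0.
Proof.
apply/seteqP; split=> // c [J [_ J0]].
rewrite (_ : J = set0); last by apply/seteqP; split.
apply: back_closure_min => [|a [x [_ [y []]]]].
by apply/Invset_minusP.
Qed.

Lemma layered_liftT : layered_lift setT = setT.
Proof.
apply/seteqP; split=> // c _; exists setT => //; apply: sub_back_closure.
by have [x gx] := grid_nonempty gg c; exists x; split=> //; exact: sub_thickening.
Qed.

Lemma level_subset J K : S K -> K `<=` J -> (h K <= h J)%N.
Proof.
move=> SK KJ; have [->//|KneJ] := eqVneq K J.
by apply/ltnW/h_lt => //; rewrite properEneq.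
Qed.

(** Cutting J along A and B gives members of S of level at most that of J, hence
of radius at least that of J. *)
Lemma layered_liftU A B : S A -> S B ->
  layered_lift (A `|` B) = layered_lift A `|` layered_lift B.
Proof.
move=> SA SB; apply/seteqP; split; last first.
  by move=> c [] ; apply: layered_lift_subset; [exact: subsetUl|exact: subsetUr].
move=> c [J [SJ JAB] Wc].
have JE : (J `&` A) `|` (J `&` B) = J by rewrite -setIUr; exact/setIidPl.
have part D : S D -> back_nbhd g F (d (h J).+1) (J `&` D) `<=` layered_lift D.
  move=> SD a Wa; exists (J `&` D); first by split; [exact: SI|exact: subIsetr].
  apply: back_nbhd_subset Wa => //; apply: d_anti; rewrite ltnS.
  by apply: level_subset; [exact: SI|exact: subIsetl].
have : back_nbhd g F (d (h J).+1) ((J `&` A) `|` (J `&` B)) c by rewrite JE.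
by move=> /back_nbhdU[/(part _ SA)|/(part _ SB)]; [left|right].
Qed.

(** The meet of incomparable members has strictly smaller level than both, so the
radii of both come after that of the meet in the sequence d. *)
Lemma layered_lift_separated J1 J2 : S J1 -> S J2 ->
  ~ J1 `<=` J2 -> ~ J2 `<=` J1 ->
  realization g (W J1) `&` realization g (W J2) `<=`
  thickening (d (h (J1 `&` J2)).+1) (J1 `&` J2).
Proof.
move=> S1 S2 n12 n21; have SK := SI S1 S2.
have hK1 : (h (J1 `&` J2) < h J1)%N.
  apply: h_lt => //; split; first exact: subIsetl.
  by rewrite subsetI => -[].
have hK2 : (h (J1 `&` J2) < h J2)%N.
  apply: h_lt => //; split; first exact: subIsetr.
  by rewrite subsetI => -[].
apply: subset_trans (d_separates (leq_trans hK1 (h_le _)) S1 S2).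
by apply: setISS; apply: realization_subset; apply: back_nbhd_subset => //;
  apply: d_anti.
Qed.

Lemma layered_liftI A B :
  layered_lift (A `&` B) = layered_lift A `&` layered_lift B.
Proof.
apply/seteqP; split.
  by rewrite subsetI; split; apply: layered_lift_subset;
    [exact: subIsetl|exact: subIsetr].
move=> c [[J1 [S1 JA] W1] [J2 [S2 JB] W2]].
have [J12|n12] := pselect (J1 `<=` J2).
  exists J1 => //; split=> //.
  by rewrite subsetI; split=> //; exact: subset_trans J12 JB.
have [J21|n21] := pselect (J2 `<=` J1).
  exists J2 => //; split=> //.
  by rewrite subsetI; split=> //; exact: subset_trans J21 JA.
exists (J1 `&` J2); first by split; [exact: SI|exact: setISS].
apply: sub_back_closure; have [x gx] := grid_nonempty gg c; exists x; split=> //.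
by apply: layered_lift_separated => //; split; exists c.
Qed.

Lemma realization_layered_liftI A B :
  realization g (layered_lift A) `&` realization g (layered_lift B) =
  realization g (layered_lift (A `&` B)).
Proof.
apply/seteqP; split; last first.
  rewrite layered_liftI subsetI; split; apply: realization_subset;
    [exact: subIsetl|exact: subIsetr].
move=> x [[c1 [J1 [S1 JA] W1] x1] [c2 [J2 [S2 JB] W2] x2]].
have [J12|n12] := pselect (J1 `<=` J2).
  exists c1 => //; exists J1 => //; split=> //.
  rewrite subsetI; split=> //; exact: subset_trans J12 JB.
have [J21|n21] := pselect (J2 `<=` J1).
  exists c2 => //; exists J2 => //; split=> //.
  rewrite subsetI; split=> //; exact: subset_trans J21 JA.
(* The two cells containing x may differ, so preservation of intersections by
   cell sets is not enough; but x itself lies in the thickening of J1 & J2. *)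
have : realization g (W (J1 `&` J2)) x.
  apply: thickening_sub_back_nbhd => //.
  by apply: layered_lift_separated => //; split; [exists c1|exists c2].
apply: realization_subset => c Wc.
by exists (J1 `&` J2) => //; split; [exact: SI|exact: setISS].
Qed.

Lemma sub_layered_lift A : S A -> A `<=` realization g (layered_lift A).
Proof.
move=> SA x /(sub_thickening (d_gt0 (h A).+1))/(thickening_sub_back_nbhd gg F).
by apply: realization_subset => c Wc; exists A => //; split.
Qed.

Lemma layered_lift_sub_thickening A :
  realization g (layered_lift A) `<=` thickening (d 0%N) A.
Proof.
move=> x [c [J [SJ JA] Wc] gx].
apply: (thickening_le (d_anti (leq0n (h J))) JA).
by rewrite -[X in thickening _ X]setIid; apply: d_separates => //; split; exists c.
Qed.

End layered_lift.

Theorem theorem4p20 (R : realType) (X : metricType R) (f : X -> X)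
    (C : nat -> finType) (g : forall n : nat, C n -> set X)
    (F : forall n : nat, C n -> set (C n)) (S : set (set X)) :
  compact [set: X] ->
  continuous f ->
  grid_cofiltration g ->
  contracting g ->
  (forall n : nat, outer_approximation f (g n) (F n)) ->
  mv_cofiltration g F ->
  mv_converges f g F ->
  sublattice (Rep f) S ->
  finite_set S ->
  exists nS : nat, forall n : nat, (nS <= n)%N ->
    exists l : set X -> set (C n),
      [/\ lattice_mono S (Invset_minus (F n)) l,
          lattice_lift S (Invset_minus (F n)) id
            (fun U => alpha f (realization (g n) U)) l &
          sublattice (RNbhd f) [set realization (g n) (l A) | A in S]].
Proof.
move=> cX cf [gg _] _ oF _ convF [SRep S0 ST SU SI] finS.
have [N [h [h_le h_lt]]] := strict_subset_level finS.
(* The radius d0 keeps |l(A)| inside a repelling neighborhood whose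
   alpha-limit set is A. *)
pose isolates e (A : set X) (n : nat) := exists2 U,
  RNbhd f U /\ A = alpha f U & thickening e A `<=` U.
have [d0 d00 [n0 _ /(_ n0 (leqnn n0)) d0P]] :
    exists2 e, 0 < e & \forall n \near \oo, forall A, S A -> isolates e A n.
  apply: finite_uniform_radius => // [e e' A n ee' [U rU AU]|A /SRep[U rU AU]].
    by exists U => //; apply: subset_trans AU; exact: thickening_le.
  have [|e e0 eU] := thickening_sub_open cX (@alpha_closed _ f U) (@open_interior _ U).
    exact: rU.
  exists e => //; near=> n; exists U => //.
  by rewrite AU; apply: subset_trans eU _; exact: interior_subset.
pose separates (d e : R) n := forall J1 J2, S J1 -> S J2 ->
  realization (g n) (back_nbhd (g n) (F n) e J1) `&`
  realization (g n) (back_nbhd (g n) (F n) e J2) `<=` thickening d (J1 `&` J2).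
have /choice[next nextP] : forall d, exists e, 0 < d ->
    [/\ 0 < e, e <= d & \forall n \near \oo, separates d e n].
  move=> d; have [d_gt0|nd] := boolP (0 < d); last by exists 0.
  have [|p n e e' /= ee'|[J1 J2] [/= /SRep R1 /SRep R2]|e e0 eP] :=
      @finite_uniform_radius R _ (S `*` S) (fun e p n =>
        realization (g n) (back_nbhd (g n) (F n) e p.1) `&`
        realization (g n) (back_nbhd (g n) (F n) e p.2) `<=`
        thickening d (p.1 `&` p.2)).
  - exact: finite_setX.
  - apply: subset_trans; apply: setISS; apply: realization_subset;
      exact: back_nbhd_subset.
  - exact: back_nbhdI_small.
  exists (Order.min d e) => _; split.
  - by rewrite lt_min d_gt0.
  - by rewrite ge_min lexx.
  apply: filterS eP => n en J1 J2 S1 S2.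
  apply: subset_trans (en (J1, J2) (conj S1 S2)) => /=.
  by apply: setISS; apply: realization_subset; apply: back_nbhd_subset => //;
    rewrite ge_min lexx orbT.
(* Only the first N.+1 radii occur as bounds, so n can be taken large
   enough for all of them at once. *)
pose d i := iter i next d0.
have d_gt0 i : 0 < d i by elim: i => //= i /nextP[].
have d_anti i j : (i <= j)%N -> d j <= d i.
  elim: j => [|j IH]; first by rewrite leqn0 => /eqP->.
  rewrite leq_eqVlt => /predU1P[->//|/IH]; apply: le_trans.
  by have [] := nextP _ (d_gt0 j).
have [nS _ nSP] : \forall n \near \oo, forall i : 'I_N.+1,
    separates (d i) (d i.+1) n.
  by apply: filter_forall => i; have [] := nextP _ (d_gt0 i).
exists nS => n /nSP sep.
have {}sep i J1 J2 : (i <= N)%N -> S J1 -> S J2 ->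
    realization (g n) (back_nbhd (g n) (F n) (d i.+1) J1) `&`
    realization (g n) (back_nbhd (g n) (F n) (d i.+1) J2) `<=`
    thickening (d i) (J1 `&` J2).
  by rewrite -ltnS => iN; exact: (sep (Ordinal iN)).
pose l := layered_lift (g n) (F n) S h d.
have rl A : RNbhd f (realization (g n) (l A)).
  by apply: (Invset_minus_RNbhd (gg n) cf (oF n)); exact: layered_lift_Invset.
have alphal A : S A -> alpha f (realization (g n) (l A)) = A.
  move=> SA; apply/seteqP; split=> x.
    have [U [_ AU] dU] := d0P A SA; move=> lx; rewrite AU.
    apply: staying_alpha => k; apply: dU.
    apply: (layered_lift_sub_thickening (h := h) (d := d) h_le d_anti sep).
    exact: RNbhd_alpha_iter (rl A) lx.
  move=> Ax; apply: staying_alpha => k; apply: sub_layered_lift => //.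
  by apply: Rep_forward => //; exact: SRep.
have homl : lattice_hom S (Invset_minus (F n)) l.
  split.
  - by move=> A _; exact: layered_lift_Invset.
  - exact: layered_lift0.
  - exact: layered_liftT.
  - by move=> A B SA SB; exact: layered_liftU.
  - by move=> A B _ _; exact: layered_liftI.
exists l; split.
- split=> // A B /set_mem SA /set_mem SB lAB.
  by rewrite -(alphal A SA) lAB alphal.
- by split=> // A /set_mem SA /=; rewrite alphal.
split.
- by move=> _ [A _ <-].
- by exists set0 => //; rewrite (lattice_hom_set0 homl) /realization bigcup_set0.
- exists setT => //; rewrite (lattice_hom_setT homl).
  by rewrite /realization; exact: grid_cover.
- move=> _ _ [A SA <-] [B SB <-]; exists (A `|` B); first exact: SU.
  by rewrite (lattice_hom_setU homl) // realizationU.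
- move=> _ _ [A SA <-] [B SB <-]; exists (A `&` B); first exact: SI.
  by rewrite (realization_layered_liftI (N := N)).
Unshelve. all: by end_near. Qed.
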